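(* Let $N\ge 3$, let $\Omega=\mathbb{R}^N\setminus\mathcal{O}$ be a punctured or exterior domain with $\mathbb{R}^N\setminus B_e(0)\subset\Omega$, and let $h:\Omega\times\mathbb{R}^+\to\mathbb{R}$ be measurable. Suppose there is a function $\tilde h:\Omega\times\mathbb{R}^+\to\mathbb{R}^+$ with $$h(x,u)\ge\tilde h(x,u)\ge 0\quad\text{for all } x\in\mathbb{R}^N\setminus B_e(0),\ u\ge 0,$$ such that condition (a) holds, and such that either condition (b) holds or (if (b) fails) both conditions (b1) and (b2) hold, where: (a) for any $x\in\mathbb{R}^N\setminus B_e(0)$, $\dfrac{\tilde h(x,s_1)}{s_1}\ge\dfrac{\tilde h(x,s_2)}{s_2}$ whenever $s_1\ge s_2>0$; (b) for any $t>0$, $\displaystyle\liminf_{|x|\to+\infty}\tilde h(x,t|x|^{2-N})\,|x|^N>\frac{(N-2)^2}{4}$; (b1) there exists $\sigma_1\in(0,1)$ such that for any $t>0$, $\displaystyle\liminf_{|x|\to+\infty}\tilde h(x,t|x|^{2-N})\,|x|^N(\ln|x|)^{\sigma_1}>0$; (b2) there exists $\sigma_2>0$ such that for any $t>0$, $\displaystyle\liminf_{|x|\to+\infty}\frac{\tilde h(x,t|x|^{2-N}(\ln|x|)^{\sigma_2})}{t|x|^{-N}(\ln|x|)^{\sigma_2}}>\frac{(N-2)^2}{4}$. Then the problem $$-\Delta u=h(x,u)\ \text{ in }\Omega,\qquad u\ge 0\ \text{ on }\partial\Omega$$ has no positive supersolution.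
   Context: $\mathbb{R}^+=[0,+\infty)$, and $B_r(0)$ is the ball of radius $r$ centered at the origin ($e$ is Euler's number). A punctured or exterior domain is a set $\Omega=\mathbb{R}^N\setminus\mathcal{O}$ where $\mathcal{O}$ is a bounded, closed, smooth subset of $\mathbb{R}^N$; typical examples are $\mathbb{R}^N\setminus\{0\}$ (punctured) and $\mathbb{R}^N\setminus\overline{B}_R(0)$ (exterior). A function $u\in C^2(\Omega)$ is a positive supersolution of the problem $-\Delta u=h(x,u)$ in $\Omega$, $u\ge0$ on $\partial\Omega$, if $u(x)>0$ and $-\Delta u(x)\ge h(x,u(x))$ for all $x\in\Omega$. *)

(* Defs.v *)
From HB Require Import structures.
From mathcomp Require Import all_boot all_order all_algebra.
From mathcomp Require Import all_classical all_reals all_analysis.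

Set Implicit Arguments.
Unset Strict Implicit.
Unset Printing Implicit Defensive.

Import Order.TTheory GRing.Theory Num.Theory.
Import numFieldNormedType.Exports.

Local Open Scope classical_set_scope.
Local Open Scope ring_scope.

Section Euclidean.
Context {R : realType} {N : nat}.
Implicit Types (x : 'rV[R]_N) (U O : set 'rV[R]_N) (f u : 'rV[R]_N -> R).

(* The norm `|x| that the library puts on row vectors is the sup norm; it gives
   the right topology and bounded sets, but |x| has to be Euclidean. *)
Definition enorm x : R := Num.sqrt (\sum_(i < N) x ord0 i ^+ 2).

Definition eball (r : R) : set 'rV[R]_N := [set x | enorm x < r].

(* The filter |x| -> +oo. *)
Definition at_infty : set_system 'rV[R]_N :=
  [set P | exists M : R, forall x, M < enorm x -> P x].

Definition partial (i : 'I_N) f : 'rV[R]_N -> R :=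
  fun x => 'D_(delta_mx ord0 i) f x.

Definition laplacian f : 'rV[R]_N -> R :=
  fun x => \sum_(i < N) partial i (partial i f) x.

(* Meant for open U, so that the values of f outside U are irrelevant. *)
Fixpoint Ck (k : nat) U f : Prop :=
  (forall x, U x -> {for x, continuous f}) /\
  if k is k'.+1 then
    forall i : 'I_N,
      (forall x, U x -> derivable f x (delta_mx ord0 i)) /\
      Ck k' U (partial i f)
  else True.

Definition Cinfty_map U (F : 'rV[R]_N -> 'rV[R]_N) : Prop :=
  forall (k : nat) (j : 'I_N), Ck k U (fun x => F x ord0 j).

(* R^d x {0}, or, if b is true and d > 0, the half-space
   R^(d-1) x [0, +oo[ x {0} of it. *)
Definition flat_model (d : nat) (b : bool) : set 'rV[R]_N :=
  [set y | forall i : 'I_N,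
     ((d <= i)%N -> y ord0 i = 0) /\
     (b -> i.+1 = d -> 0 <= y ord0 i)].

(* Embedded smooth submanifolds, possibly with boundary, of any dimension
   (which may depend on the connected component): points and closed balls are
   both instances, with d = 0 and d = N respectively. *)
Definition smooth_subset O : Prop :=
  forall p, O p ->
  exists (d : nat) (b : bool) (U V : set 'rV[R]_N)
         (Phi Psi : 'rV[R]_N -> 'rV[R]_N),
    [/\ (d <= N)%N,
        [/\ open U, open V & U p],
        Cinfty_map U Phi /\ Cinfty_map V Psi,
        (forall x, U x -> V (Phi x) /\ Psi (Phi x) = x) /\
        (forall y, V y -> U (Psi y) /\ Phi (Psi y) = y)
      & forall x, U x -> (O x <-> flat_model d b (Phi x))].

Definition punctured_or_exterior (Omega : set 'rV[R]_N) : Prop :=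
  exists O : set 'rV[R]_N,
    [/\ bounded_set O, closed O, smooth_subset O & Omega = ~` O].

(* Balls of 'rV[R]_N * R for the library (sup) norm are cubes, so the N.+1
   dimensional volume of ball c r is (2 r)^(N + 1). *)
Definition lebesgue_null (A : set ('rV[R]_N * R)) : Prop :=
  forall eps : R, 0 < eps ->
  exists (c : nat -> 'rV[R]_N * R) (r : nat -> R),
    [/\ forall k, 0 <= r k,
        A `<=` \bigcup_k ball (c k) (r k)
      & (\sum_(0 <= k <oo) ((2 * r k) ^+ N.+1)%:E <= eps%:E)%E].

(* The Lebesgue sigma-algebra of R^N x R = R^(N+1) is generated by the open
   sets and the null sets. *)
Definition lebesgue_generators : set (set ('rV[R]_N * R)) :=
  [set A | open A \/ lebesgue_null A].

Definition lebesgue_measurable_fun (D : set ('rV[R]_N * R))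
    (g : 'rV[R]_N * R -> R) : Prop :=
  measurable_fun (D : set (g_sigma_algebraType lebesgue_generators)) g.

(* Only the values h x s with x in Omega and 0 <= s matter, and only the values
   of u on Omega.  The boundary inequality u >= 0 adds no condition. *)
Definition positive_supersolution (Omega : set 'rV[R]_N)
    (h : 'rV[R]_N -> R -> R) u : Prop :=
  Ck 2 Omega u /\
  forall x, Omega x -> 0 < u x /\ h x (u x) <= - laplacian u x.

End Euclidean.
Arguments eball {R N} r.
Arguments at_infty {R N}.

(* Main.v *)
Require Import Defs.
From HB Require Import structures.
From mathcomp Require Import all_boot all_order all_algebra.
From mathcomp Require Import all_classical all_reals all_analysis.
From mathcomp Require Import ring lra.

Set Implicit Arguments.
Unset Strict Implicit.
Unset Printing Implicit Defensive.

Import Order.TTheory GRing.Theory Num.Theory.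
Import numFieldNormedType.Exports.

Local Open Scope classical_set_scope.
Local Open Scope ring_scope.

(** The nonlinearity enters only through the quotient [ht x s / s], which grows
with [s].  So a pointwise lower bound [w <= u] turns the supersolution [u] into
a supersolution of a linear equation, with potential [ht x (w x) / w x].  The
nonexistence then rests on the Hardy constant: if the potential is at least
[lam / |x|^2] near infinity with [lam > (N - 2)^2 / 4], radial solutions
oscillate and no positive supersolution survives ([hardy_nonexistence]).

The lower bounds come in two stages.  Outside the ball of radius e the function
[u] is superharmonic, hence at least a multiple of the fundamental solution
[|x|^(2 - N)] ([fundamental_lower_bound]).  Under the first alternative of the
theorem this bound already gives a potential above the Hardy constant.  Under
the second one it gives a potential of order [|x|^-2 (ln |x|)^-sigma1]; since
[sigma1 < 1], this raises the lower bound to [|x|^(2 - N) (ln |x|)^n] for every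
integer [n] ([log_power_lower_bound]), and [n >= sigma2] brings the remaining
hypothesis, hence the Hardy constant, into play.

All three linear statements follow from one comparison principle on annuli
([radial_comparison]), with explicit radial barriers that are nonpositive on the
outer sphere, so that the positivity of [u] is the only information on [u]
used there.  The principle is the second derivative test at a maximum of the
quotient barrier / [u].
In the variable [s = ln |x|] the operator [|x|^2 Laplacian] acts on radial
functions [k (ln |x|)] as [k'' + (N - 2) k'], with constant coefficients, which
makes the barriers elementary. *)

(** * Second derivatives at a minimum, lines and annuli *)

(** A negative [L] would make [f1], which vanishes at the minimum, negative just
to the right of [0]; the mean value theorem then puts [f] below [f 0]. *)
Lemma second_derivative_ge0_at_min (R : realType) (f f1 : R -> R) (L : R) :
  (\forall t \near (0 : R), is_derive (t : R) (1 : R) f (f1 t)) ->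
  is_derive (0 : R) (1 : R) f1 L ->
  (\forall t \near (0 : R), f 0 <= f t) ->
  0 <= L.
Proof.
move=> Df [] Df1 DL fmin; rewrite leNgt; apply/negP => L0.
have /nbhs_ballP[e /= e0 He] : \forall t \near (0 : R),
    is_derive (t : R) (1 : R) f (f1 t) /\ f 0 <= f t.
  near=> t; split; near: t; [exact: Df|exact: fmin].
have inb (t : R) : `|t| < e -> is_derive t (1 : R) f (f1 t) /\ f 0 <= f t.
  by move=> te; apply: He; rewrite /ball /= sub0r normrN.
have f10 : f1 0 = 0.
  have D0 : is_derive (0 : R) 1 f 0.
    apply: (@derive1_at_min R f (- (e / 2)) (e / 2)) => //.
    - lra.
    - move=> t; rewrite in_itv/= => /andP[? ?].
      by have [[]] := inb t (ltac:(rewrite ltr_norml; lra)).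
    - by rewrite in_itv/=; lra.
    - move=> t; rewrite in_itv/= => /andP[? ?].
      by apply: (inb _ _).2; rewrite ltr_norml; lra.
  have [+ _] := inb 0 (ltac:(by rewrite normr0)).
  by move=> [_ <-]; case: D0.
have /nbhs_ballP[d /= d0 Hd] : \forall h \near (0 : R)^', h^-1 * f1 h < 0.
  have : (fun h : R => h^-1 *: (f1 (h *: 1 + 0) - f1 0)) @ 0^' --> L.
    by rewrite -DL; exact: Df1.
  move/(_ [set y | y < 0]) => /= H.
  have := H (lt_nbhsl L0); rewrite /nbhs /=.
  by apply: filterS => h /=; rewrite f10 subr0 addr0 [_ *: 1]mulr1.
have f1neg t : 0 < t -> t < d -> f1 t < 0.
  move=> t0 td; have := Hd t; rewrite /ball /= sub0r normrN gtr0_norm// => /(_ td).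
  by rewrite gt_eqF// => /(_ isT); rewrite pmulr_rlt0 ?invr_gt0.
pose b := Num.min d e / 2.
have b0 : 0 < b by rewrite divr_gt0// lt_min d0.
have bd : b < d by rewrite ltr_pdivrMr// (le_lt_trans (y:= d)) ?ge_min ?lexx//; lra.
have be : b < e by rewrite ltr_pdivrMr// (le_lt_trans (y:= e)) ?ge_min ?lexx ?orbT//; lra.
have [||c] := @MVT R f f1 0 b b0.
- by move=> t; rewrite in_itv/= => /andP[? ?]; apply: (inb _ _).1; rewrite ltr_norml; lra.
- apply: derivable_within_continuous => t; rewrite in_itv/= => /andP[? ?].
  by have [[]] := inb t (ltac:(rewrite ltr_norml; lra)).
rewrite in_itv/= subr0 => /andP[c0 cb] fb.
have := (inb b (ltac:(rewrite ltr_norml; lra))).2.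
rewrite -subr_ge0 fb leNgt nmulr_rlt0 ?b0//.
by apply: f1neg => //; lra.
Unshelve. all: by end_near. Qed.

Section Lines.
Context {R : realType} {N : nat}.
Implicit Types (x v : 'rV[R]_N) (f : 'rV[R]_N -> R).

Lemma is_derive_line f x v (t : R) :
  derivable f (t *: v + x) v ->
  is_derive t (1 : R) (fun s : R => f (s *: v + x)) ('D_v f (t *: v + x)).
Proof.
have E : (fun h : R => h^-1 *: (f ((h *: 1 + t) *: v + x) - f (t *: v + x)))
   = (fun h : R => h^-1 *: (f (h *: v + (t *: v + x)) - f (t *: v + x))).
  by apply/funext => h; rewrite [_ *: 1]mulr1 scalerDl addrA.
by move=> df; split; rewrite /derivable /derive E.
Qed.

Lemma enorm_ge0 x : 0 <= enorm x.
Proof. exact: sqrtr_ge0. Qed.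

Lemma enorm_sqr x : enorm x ^+ 2 = \sum_(i < N) x ord0 i ^+ 2.
Proof. by rewrite sqr_sqrtr// sumr_ge0// => i _; rewrite sqr_ge0. Qed.

Lemma enorm_line x i (t : R) :
  enorm (t *: delta_mx ord0 i + x) ^+ 2 =
  enorm x ^+ 2 + 2 * x ord0 i * t + t ^+ 2.
Proof.
rewrite !enorm_sqr (bigD1 i)//= [in RHS](bigD1 i)//= !mxE !eqxx/=.
rewrite (eq_bigr (fun j => x ord0 j ^+ 2)); first by ring.
by move=> j ji; rewrite !mxE (negbTE ji) andbF mulr0 add0r.
Qed.

Lemma continuous_enorm : continuous (@enorm R N).
Proof.
move=> x; rewrite /enorm.
apply: (@continuous_comp _ _ _
  (fun x : 'rV[R]_N => \sum_(i < N) x ord0 i ^+ 2) (@Num.sqrt R)).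
  apply: (@continuous_big _ _ +%R) => //; first exact: add_continuous.
  move=> i _ y; apply: (@continuous_comp _ _ _ (fun x : 'rV[R]_N => x ord0 i)
    (fun s : R => s ^+ 2)); [exact: coord_continuous|exact: exprn_continuous].
exact: sqrt_continuous.
Qed.

Lemma coord_le_enorm x i : `|x ord0 i| <= enorm x.
Proof.
rewrite -sqrtr_sqr ler_wsqrtr// (bigD1 i)//= lerDl sumr_ge0// => j _.
by rewrite sqr_ge0.
Qed.

Lemma compact_annulus (a b : R) :
  compact [set x : 'rV[R]_N | a <= enorm x <= b].
Proof.
apply: bounded_closed_compact.
  exists `|b|; split; first exact: num_real.
  move=> M bM x /= /andP[_ xb]; rewrite [leLHS]/Num.norm /= mx_normrE.
  apply/bigmax_leP; split=> [|[i j] _ /=]; first exact: le_trans (ltW bM).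
  rewrite (ord1 i) (le_trans (coord_le_enorm _ _))// (le_trans xb)//.
  by rewrite (le_trans (ler_norm _))// ltW.
rewrite (_ : mkset _ = @enorm R N @^-1` `[a, b]%classic); last first.
  by apply/seteqP; split => x /=; rewrite in_itv.
by apply: closed_comp => [x _|]; [exact: continuous_enorm|exact: itv_closed].
Qed.

Lemma enorm_scale_delta (i : 'I_N) (r : R) : 0 <= r ->
  enorm (r *: delta_mx ord0 i : 'rV[R]_N) = r.
Proof.
move=> r0; have E0 : enorm (0 : 'rV[R]_N) ^+ 2 = 0.
  by rewrite enorm_sqr big1// => j _; rewrite mxE expr0n.
have := enorm_line 0 i r; rewrite addr0 E0 mxE mulr0 mul0r !add0r.
by move/eqP; rewrite eqrXn2// ?enorm_ge0// => /eqP.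
Qed.
End Lines.

(** * Radial functions touching from below *)

Section Touching.
Context {R : realType} {N : nat}.
Implicit Types (x : 'rV[R]_N) (U : set 'rV[R]_N) (u : 'rV[R]_N -> R).

Lemma is_derive_log_sqrt_quadratic (b c t : R) :
  0 < c + 2 * b * t + t ^+ 2 ->
  is_derive (t : R) (1 : R) (fun t => ln (c + 2 * b * t + t ^+ 2) / 2)
    ((b + t) / (c + 2 * b * t + t ^+ 2)).
Proof.
set rho : R -> R := fun t => c + 2 * b * t + t ^+ 2 => rho_gt0.
have Drho : is_derive (t : R) (1 : R) rho (2 * (b + t)).
  by apply: is_derive_eq; rewrite /GRing.scale /=; ring.
have Dln := @is_derive1_comp _ _ rho _ _ _ (is_derive1_ln rho_gt0) Drho.
rewrite (_ : (fun _ => _) = 2^-1 \*: (@ln R \o rho)).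
  by apply: is_derive_eq; rewrite /GRing.scale /=; field; lra.
by apply/funext => s /=; rewrite mulrC.
Qed.

(** Along the coordinate line through [x], both [u] and [k (ln |.|)] become
functions of one real variable; their difference has a minimum at [0], and the
left-hand side below is the second derivative of [k (ln |.|)] there. *)
Lemma second_partial_touching U u x (i : 'I_N) (k k1 k2 : R -> R) :
  open U -> Ck 2 U u -> U x -> 0 < enorm x ->
  (forall s, is_derive (s : R) (1 : R) k (k1 s)) ->
  (forall s, is_derive (s : R) (1 : R) k1 (k2 s)) ->
  (\forall y \near x, k (ln (enorm y)) <= u y) ->
  k (ln (enorm x)) = u x ->
  k2 (ln (enorm x)) * (x ord0 i / enorm x ^+ 2) ^+ 2 +
    k1 (ln (enorm x)) * ((enorm x ^+ 2)^-1 - 2 * (x ord0 i / enorm x ^+ 2) ^+ 2)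
    <= partial i (partial i u) x.
Proof.
move=> oU [_ /(_ i)[du [_ /(_ i)[ddu _]]]] Ux x0 Dk Dk1 touch touchx.
set s := ln (enorm x); set b := x ord0 i; set c := enorm x ^+ 2.
set e := delta_mx ord0 i : 'rV[R]_N.
have c0 : 0 < c by rewrite exprn_gt0.
pose rho t := c + 2 * b * t + t ^+ 2.
have rhoE t : enorm (t *: e + x) ^+ 2 = rho t by exact: enorm_line.
have line_cvg : (fun t : R => t *: e + x) @ (0 : R) --> x.
  have : (fun t : R => t *: e + x) @ (0 : R) --> 0 *: e + x.
    by apply: cvgD; [apply: cvgZr_tmp; exact: cvg_id|exact: cvg_cst].
  by rewrite scale0r add0r.
have ln_line t : 0 < rho t -> ln (enorm (t *: e + x)) = ln (rho t) / 2.
  rewrite -rhoE => rt; rewrite lnXn; first by rewrite mulr2n; field.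
  rewrite lt_neqAle enorm_ge0 andbT; apply: contraTN rt => /eqP <-.
  by rewrite expr0n ltxx.
have rho0 : rho 0 = c by rewrite /rho; ring.
have nearU : \forall t \near (0 : R), U (t *: e + x).
  by apply: line_cvg; apply: open_nbhs_nbhs.
have near_touch : \forall t \near (0 : R),
    k (ln (enorm (t *: e + x))) <= u (t *: e + x).
  by apply: (line_cvg [set y | k (ln (enorm y)) <= u y]).
have nearrho : \forall t \near (0 : R), 0 < rho t.
  have : (enorm (t *: e + x)) @[t --> (0 : R)] --> enorm x.
    by apply: cvg_comp line_cvg _; exact: continuous_enorm.
  move/cvgr_gt => /(_ _ x0); apply: filterS => t et.
  by rewrite -rhoE exprn_gt0.
pose g t := ln (rho t) / 2.
pose f t := u (t *: e + x) - k (g t).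
pose f1 t := partial i u (t *: e + x) - k1 (g t) * ((b + t) / rho t).
have Dg t : 0 < rho t -> is_derive (t : R) (1 : R) g ((b + t) / rho t).
  exact: is_derive_log_sqrt_quadratic.
have g0 : g 0 = s.
  by rewrite /g -ln_line ?rho0// scale0r add0r.
rewrite -subr_ge0.
apply: (@second_derivative_ge0_at_min R f f1).
- near=> t.
  have D1 : is_derive (t : R) (1 : R) (fun t => u (t *: e + x))
      (partial i u (t *: e + x)).
    by apply: is_derive_line; apply: du; near: t.
  have D2 : is_derive (t : R) (1 : R) (k \o g) (k1 (g t) * ((b + t) / rho t)).
    have rt : 0 < rho t by near: t.
    exact: (@is_derive1_comp _ k g _ _ _ (Dk (g t)) (Dg t rt)).
  exact: is_deriveB.
- have D1 : is_derive (0 : R) (1 : R) (fun t => partial i u (t *: e + x))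
     (partial i (partial i u) x).
    have /is_derive_line : derivable (partial i u) (0 *: e + x) e.
      by rewrite scale0r add0r; exact: ddu.
    by rewrite scale0r add0r.
  have D2 : is_derive (0 : R) (1 : R) (k1 \o g) (k2 s * ((b + 0) / rho 0)).
    have r0 : 0 < rho 0 by rewrite rho0.
    by rewrite -g0; exact: (@is_derive1_comp _ k1 g _ _ _ (Dk1 (g 0)) (Dg 0 r0)).
  have Drho : is_derive (0 : R) (1 : R) rho (2 * b).
    by apply: is_derive_eq; rewrite /GRing.scale /=; ring.
  have D3 : is_derive (0 : R) (1 : R) (fun t => (b + t) / rho t)
     (c^-1 - 2 * (b / c) ^+ 2).
    have DV : is_derive (0 : R) (1 : R) (fun t => (rho t)^-1) (- c ^- 2 * (2 * b)).
      by rewrite -rho0; apply: is_deriveV; rewrite rho0 gt_eqF.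
    apply: is_derive_eq; rewrite /GRing.scale /= rho0; field; lra.
  apply: is_derive_eq; rewrite /GRing.scale /= rho0 g0 addr0; field; lra.
- near=> t.
  have -> : f 0 = 0 by rewrite /f g0 scale0r add0r touchx subrr.
  rewrite subr_ge0 /g -ln_line; last by near: t.
  by near: t.
Unshelve. all: by end_near. Qed.

(** Summing the previous inequality over the coordinates compares Laplacians:
[|x|^2] times the Laplacian of [k (ln |x|)] is [k'' + (N - 2) k'], because in
logarithmic radius the radial operator has constant coefficients. *)
Lemma laplacian_touching U u x (k k1 k2 : R -> R) :
  open U -> Ck 2 U u -> U x -> 0 < enorm x ->
  (forall s, is_derive (s : R) (1 : R) k (k1 s)) ->
  (forall s, is_derive (s : R) (1 : R) k1 (k2 s)) ->
  (\forall y \near x, k (ln (enorm y)) <= u y) ->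
  k (ln (enorm x)) = u x ->
  k2 (ln (enorm x)) + (N%:R - 2) * k1 (ln (enorm x))
    <= enorm x ^+ 2 * laplacian u x.
Proof.
move=> oU Cu Ux x0 Dk Dk1 touch touchx.
have c0 : 0 < enorm x ^+ 2 by rewrite exprn_gt0.
rewrite -ler_pdivrMl//.
have sum_sqr : \sum_(i < N) (x ord0 i / enorm x ^+ 2) ^+ 2 = (enorm x ^+ 2)^-1.
  under eq_bigr do rewrite expr_div_n.
  by rewrite -mulr_suml -enorm_sqr; field; lra.
apply: (@le_trans _ _ (\sum_(i < N) _)); last first.
  apply: ler_sum => i _.
  exact: (second_partial_touching i oU Cu Ux x0 Dk Dk1 touch touchx).
rewrite big_split /= -!mulr_sumr big_split /= sumrN sumr_const card_ord.
rewrite -mulr_sumr sum_sqr -[_ *+ N]mulr_natr le_eqVlt; apply/orP; left.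
by apply/eqP; field; lra.
Qed.

End Touching.

(** * Comparison with radial barriers *)

Section Comparison.
Context {R : realType} {N : nat}.
Implicit Types (x : 'rV[R]_N) (U : set 'rV[R]_N) (u : 'rV[R]_N -> R).

(** Positive supersolutions of [- Laplacian u = q (ln |x|) |x|^-2 u] for
[|x| >= expR a].  The inequality is multiplied by [|x|^2], which is the form that
depends on [|x|] through [ln |x|] alone. *)
Definition log_potential_supersolution U (q : R -> R) (a : R) u : Prop :=
  [/\ open U, Ck 2 U u
    & forall x, expR a <= enorm x ->
      [/\ U x, 0 < u x
        & q (ln (enorm x)) * u x <= - (enorm x ^+ 2 * laplacian u x)]].

Lemma log_potential_supersolution_le U (q : R -> R) (a a' : R) u : a <= a' ->
  log_potential_supersolution U q a u -> log_potential_supersolution U q a' u.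
Proof.
move=> aa' [oU Cu Hu]; split=> // x xa; apply: Hu.
by rewrite (le_trans _ xa)// ler_expR.
Qed.

Lemma expR_le_ln (a r : R) : expR a <= r -> 0 < r /\ a <= ln r.
Proof.
move=> ar; have r0 := lt_le_trans (expR_gt0 a) ar; split=> //.
by rewrite -ler_expR lnK.
Qed.

Lemma supersolution_sphere_ge U (q : R -> R) (a : R) u :
  log_potential_supersolution U q a u ->
  exists2 c, 0 < c & forall x, enorm x = expR a -> c <= u x.
Proof.
move=> [oU [Cu _] Hu]; pose S := [set x : 'rV[R]_N | expR a <= enorm x <= expR a].
have [S0|/set0P/negP/negPn/eqP S0] := pselect (S !=set0); last first.
  exists 1 => // x xa; have : S x by rewrite /S /= xa lexx.
  by rewrite S0.
have [||z zS zmin] := @compact_EVT_min _ R u S S0.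
- exact: compact_annulus.
- by apply/continuous_in_subspaceT => z; rewrite inE => /andP[/Hu[Uz _ _] _]; exact: Cu.
exists (u z) => [|x xa].
  by move: zS; rewrite inE => /andP[/Hu[]].
by apply: zmin; rewrite inE /S /= xa lexx.
Qed.

(** Since [k b <= 0], nothing has to be known about [u] on the outer sphere beyond
its sign, and [m] does not depend on [b]: this is what lets barriers reach out
to infinity.  If the maximum of [k (ln |x|) / u x] over the annulus exceeded [m],
it would be attained in the interior; there the rescaled barrier touches [u]
from below, and [laplacian_touching] contradicts the strict subsolution
inequality.  Only points where [k] is positive matter, as the maximum is. *)
Lemma radial_comparison U (q : R -> R) (a b m : R) u (k k1 k2 : R -> R) :
  log_potential_supersolution U q a u ->
  (forall s, is_derive (s : R) (1 : R) k (k1 s)) ->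
  (forall s, is_derive (s : R) (1 : R) k1 (k2 s)) ->
  (forall s, a < s -> 0 < k s -> 0 < k2 s + (N%:R - 2) * k1 s + q s * k s) ->
  0 <= m ->
  (forall x, enorm x = expR a -> k a <= m * u x) ->
  k b <= 0 ->
  forall x, expR a <= enorm x <= expR b -> k (ln (enorm x)) <= m * u x.
Proof.
move=> [oU Cu Hu] Dk Dk1 subk m0 ka kb x xab.
pose S := [set x : 'rV[R]_N | expR a <= enorm x <= expR b].
pose f x := k (ln (enorm x)) / u x.
have ck (s : R) : {for s, continuous k}.
  by apply/differentiable_continuous/derivable1_diffP; case: (Dk s).
have clnn (z : 'rV[R]_N) : 0 < enorm z -> {for z, continuous (fun y => ln (enorm y))}.
  move=> z0; exact: (@continuous_comp _ _ _ (@enorm R N) (@ln R) z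
    (@continuous_enorm R N z) (continuous_ln z0)).
have [|||z] := @compact_EVT_max _ R f S.
- by exists x.
- exact: compact_annulus.
- apply/continuous_in_subspaceT => z; rewrite inE => /andP[az _].
  have [Uz uz _] := Hu z az; have [z0 _] := expR_le_ln az.
  apply: (@continuousM R _ (fun z => k (ln (enorm z))) (fun z => (u z)^-1)).
    by apply: (@continuous_comp _ _ _ (fun y => ln (enorm y)) k); [exact: clnn|exact: ck].
  by apply: continuousV; [rewrite gt_eqF|case: Cu => + _; exact].
rewrite inE => /andP[az zb] zmax.
have [Uz uz superz] := Hu z az; have [z0 alnz] := expR_le_ln az.
have le_max y : S y -> k (ln (enorm y)) <= f z * u y.
  move=> Sy; have [_ uy _] := Hu y (ltac:(by case/andP: Sy)).
  by rewrite -ler_pdivrMr//; apply: zmax; rewrite inE.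
have [fzm|mfz] := leP (f z) m.
  apply: le_trans (le_max x xab) _.
  by rewrite ler_wpM2r//; have [_ /ltW] := Hu x (ltac:(by case/andP: xab)).
have fz0 : 0 < f z by exact: le_lt_trans mfz.
have fzE : k (ln (enorm z)) = f z * u z by rewrite /f divfK// gt_eqF.
have kz0 : 0 < k (ln (enorm z)) by rewrite fzE mulr_gt0.
have az' : a < ln (enorm z).
  rewrite lt_neqAle alnz andbT; apply/eqP => aE.
  have zE : enorm z = expR a by rewrite aE lnK.
  by have := ka z zE; rewrite [in k a]aE fzE ler_pM2r// leNgt mfz.
have zb' : ln (enorm z) < b.
  rewrite lt_neqAle -[in X in _ && X]ler_expR lnK// zb andbT; apply/eqP => bE.
  by move: kb; rewrite -bE leNgt kz0.
(* The barrier divided by its maximal ratio touches [u] from below at [z]. *)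
exfalso.
have touch : \forall y \near z, (f z)^-1 * k (ln (enorm y)) <= u y.
  have n1 : \forall y \near z, 0 < enorm y.
    exact: (cvgr_gt _ (@continuous_enorm R N z)).
  have n2 : \forall y \near z, a < ln (enorm y) by exact: (cvgr_gt _ (clnn z z0)).
  have n3 : \forall y \near z, ln (enorm y) < b by exact: (cvgr_lt _ (clnn z z0)).
  near=> y; rewrite ler_pdivrMl//.
  have y0 : 0 < enorm y by near: y.
  apply: le_max; apply/andP; split.
    by rewrite -[leRHS]lnK// ler_expR ltW//; near: y.
  by rewrite -[leLHS]lnK// ler_expR ltW//; near: y.
have DZ (g g1 : R -> R) (s : R) : is_derive (s : R) (1 : R) g (g1 s) ->
    is_derive (s : R) (1 : R) (fun s => (f z)^-1 * g s) ((f z)^-1 * g1 s).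
  by move=> Dg; exact: (is_deriveZ _ Dg).
have := laplacian_touching oU Cu Uz z0 (fun s => DZ _ _ s (Dk s))
  (fun s => DZ _ _ s (Dk1 s)) touch.
rewrite fzE mulKf ?gt_eqF// => /(_ erefl).
have := subk _ az' kz0.
rewrite fzE => sub le_lap.
have {}le_lap : (f z)^-1 * (k2 (ln (enorm z)) + (N%:R - 2) * k1 (ln (enorm z)) +
    q (ln (enorm z)) * (f z * u z)) <= 0.
  rewrite -(subrr (enorm z ^+ 2 * laplacian u z)) -subr_ge0.
  move: le_lap superz; rewrite -subr_ge0 -[X in _ -> is_true X -> _]subr_ge0.
  move=> l1 l2; apply: le_trans (addr_ge0 l1 l2) _.
  by rewrite le_eqVlt; apply/orP; left; apply/eqP; field; lra.
by move: le_lap; rewrite leNgt mulr_gt0// invr_gt0.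
Unshelve. all: by end_near. Qed.

End Comparison.

(** * The three barriers *)

Section Barriers.
Context {R : realType} {N : nat}.
Implicit Types (x : 'rV[R]_N) (U : set 'rV[R]_N) (u : 'rV[R]_N -> R).

Lemma is_derive_expZ (p s : R) :
  is_derive (s : R) (1 : R) (fun s => expR (p * s)) (p * expR (p * s)).
Proof.
have Dp : is_derive (s : R) (1 : R) (fun s => p * s) p.
  by apply: is_derive_eq; rewrite /GRing.scale /=; ring.
apply: is_derive_eq (@is_derive1_comp _ expR (fun s => p * s) _ _ _ _ Dp) _.
by rewrite mulrC.
Qed.

(** The barrier is [|x|^(2 - N) + |x|^(1 - N) - eps]: the fundamental solution is
harmonic, the second term makes the sum strictly subharmonic, and [eps] makes
it nonpositive far away. *)
Lemma fundamental_lower_bound U u (a : R) : (2 < N)%N -> 0 <= a ->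
  log_potential_supersolution U (fun=> 0) a u ->
  exists2 c, 0 < c & forall x, expR a <= enorm x ->
    c * expR ((2 - N%:R) * ln (enorm x)) <= u x.
Proof.
move=> N2 a0 Hu; have [c0 c0_gt0 uc] := supersolution_sphere_ge Hu.
have N2r : 2 < N%:R :> R by rewrite ltr_nat.
pose d : R := N%:R - 2.
have d0 : 0 < d by rewrite subr_gt0.
pose K := expR (- d * a) + expR (- (d + 1) * a).
have K0 : 0 < K by rewrite addr_gt0 ?expR_gt0.
exists (c0 / K) => [|x ax]; first by rewrite divr_gt0.
have [x0 aln] := expR_le_ln ax; set s0 := ln (enorm x) in aln *.
(* With this [eps] the barrier at [x] is exactly [|x|^(2 - N)]. *)
pose eps := expR (- (d + 1) * s0).
pose k s := expR (- d * s) + expR (- (d + 1) * s) - eps.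
pose k1 s := - d * expR (- d * s) - (d + 1) * expR (- (d + 1) * s).
pose k2 s := d ^+ 2 * expR (- d * s) + (d + 1) ^+ 2 * expR (- (d + 1) * s).
have Dk s : is_derive (s : R) (1 : R) k (k1 s).
  have D1 := is_derive_expZ (- d) s; have D2 := is_derive_expZ (- (d + 1)) s.
  by apply: is_derive_eq; rewrite /k1 /GRing.scale /=; ring.
have Dk1 s : is_derive (s : R) (1 : R) k1 (k2 s).
  have D1 := is_derive_expZ (- d) s; have D2 := is_derive_expZ (- (d + 1)) s.
  apply: is_derive_eq; rewrite /k2 /GRing.scale /=; ring.
(* The choice of [b] makes [eps = e * expR (- d * b)], and [e >= 2] lets [eps]
   absorb both exponentials. *)
pose b := s0 + (s0 + 1) / d.
have s0_ge0 : 0 <= s0 by exact: le_trans a0 aln.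
have sb : s0 <= b by rewrite lerDl divr_ge0 ?ltW//; lra.
have kb : k b <= 0.
  have b0 : 0 <= b by exact: le_trans sb.
  have le1 : expR (- (d + 1) * b) <= expR (- d * b) by rewrite ler_expR; nra.
  have le2 : 2 * expR (- d * b) <= eps.
    have -> : eps = expR 1 * expR (- d * b).
      rewrite -expRD /eps /b; congr expR; field; lra.
    by rewrite ler_wpM2r ?expR_ge0//; have := expR_ge1Dx (1 : R); lra.
  by rewrite /k; lra.
have eps0 : 0 < eps by exact: expR_gt0.
have := radial_comparison Hu Dk Dk1 (m := K / c0) _ _ _ kb (x := x).
rewrite -/s0 => H.
have : k s0 <= K / c0 * u x.
  apply: H.
  - move=> s _ _; rewrite mul0r addr0 -/d.
    have -> : k2 s + d * k1 s = (d + 1) * expR (- (d + 1) * s).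
      by rewrite /k2 /k1; ring.
    have e1 := expR_gt0 (- (d + 1) * s).
    by rewrite mulr_gt0//; lra.
  - by rewrite divr_ge0 ?ltW.
  - move=> y /uc cy; rewrite /k -/K; apply: (@le_trans _ _ K); first by lra.
    by rewrite -mulrA ler_peMr ?(ltW K0)// mulrC ler_pdivlMr// mul1r.
  - rewrite ax /=; apply: le_trans (_ : expR s0 <= _); first by rewrite lnK.
    by rewrite ler_expR.
have -> : k s0 = expR ((2 - N%:R) * s0).
  by rewrite /k /eps addrK /d opprB.
move=> lower; have c0K : 0 <= c0 / K by rewrite divr_ge0 ?ltW.
have := ler_wpM2l c0K lower; rewrite mulrA (_ : c0 / K * (K / c0) = 1) ?mul1r//.
by field; rewrite !gt_eqF.
Qed.

(** With [d = N - 2], [n = j + 2] and the barrier [|x|^-d g (ln |x|)],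
[k'' + d k' + q k] becomes [expR (- d s) (g'' - d g' + q g)].  For
[g = s^n - eps s^(2 n)] and [th = eps s^n] in [(0, 1)], the first order term is
[- d n s^(n - 1) (1 - 2 th)] and the potential contributes
[q s^n (1 - th)].  Thus [q s >= d n] leaves at least
[d n th s^(n - 1)], and [d s >= 4 n] makes this dominate the negative part of [g''].
The exponent starts at [2] so that [n (n - 1) > 0] keeps the inequality strict. *)
Lemma log_power_lower_bound U u (q : R -> R) (a : R) (j : nat) :
  (2 < N)%N -> 0 < a ->
  (forall s, a <= s -> (N%:R - 2) * j.+2%:R <= q s * s) ->
  4 * j.+2%:R <= (N%:R - 2) * a ->
  log_potential_supersolution U q a u ->
  exists2 c, 0 < c & forall x, expR a <= enorm x ->
    c * (expR ((2 - N%:R) * ln (enorm x)) * ln (enorm x) ^+ j.+2) <= u x.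
Proof.
move=> N2 a0 hq ha Hu; have [c0 c0_gt0 uc] := supersolution_sphere_ge Hu.
have N2r : 2 < N%:R :> R by rewrite ltr_nat.
pose d : R := N%:R - 2; pose n : R := j.+2%:R.
have d0 : 0 < d by rewrite subr_gt0.
have n2 : 2 <= n by rewrite ler_nat.
have jE : j%:R = n - 2 by rewrite /n -addn2 natrD addrK.
pose K := expR (- d * a) * a ^+ j.+2.
have K0 : 0 < K by rewrite mulr_gt0 ?expR_gt0 ?exprn_gt0.
exists (c0 / K / 2) => [|x ax]; first by rewrite !divr_gt0.
have [x0 aln] := expR_le_ln ax; set s0 := ln (enorm x) in aln *.
have s0_gt0 : 0 < s0 by exact: lt_le_trans aln.
(* With this [eps] half of the leading term survives at [x], while the barrier
   is already nonpositive at logarithmic radius [2 * s0]. *)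
pose eps := (s0 ^+ j.+2)^-1 / 2.
have eps0 : 0 < eps by rewrite divr_gt0 ?invr_gt0 ?exprn_gt0.
pose g s := s ^+ j.+2 - eps * s ^+ (j + j).+4.
pose g1 s := j.+2%:R * s ^+ j.+1 - eps * ((j + j).+4%:R * s ^+ (j + j).+3).
pose g2 s := j.+2%:R * (j.+1%:R * s ^+ j)
  - eps * ((j + j).+4%:R * ((j + j).+3%:R * s ^+ (j + j).+2)).
pose E s := expR (- d * s).
pose k s := E s * g s.
pose k1 s := E s * (g1 s - d * g s).
pose k2 s := E s * (g2 s - 2 * d * g1 s + d ^+ 2 * g s).
have DE s : is_derive (s : R) (1 : R) E (- d * E s) by exact: is_derive_expZ.
have DX m s : is_derive (s : R) (1 : R) (fun s => s ^+ m.+1) (m.+1%:R * s ^+ m).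
  by split; [exact: exprn_derivable|rewrite exp_derive /GRing.scale /= mulr1].
have Dg s : is_derive (s : R) (1 : R) g (g1 s).
  rewrite (_ : g = (fun s => s ^+ j.+2) - eps \*: (fun s => s ^+ (j + j).+4))//.
  by have D1 := DX j.+1 s; have D2 := DX (j + j).+3 s; apply: is_derive_eq.
have Dg1 s : is_derive (s : R) (1 : R) g1 (g2 s).
  rewrite (_ : g1 = j.+2%:R \*: (fun s => s ^+ j.+1)
    - eps \*: ((j + j).+4%:R \*: (fun s => s ^+ (j + j).+3)))//.
  by have D1 := DX j s; have D2 := DX (j + j).+2 s; apply: is_derive_eq.
have Dk s : is_derive (s : R) (1 : R) k (k1 s).
  rewrite (_ : k = E \* g)//.
  by apply: is_derive_eq; rewrite /k1 /GRing.scale /=; ring.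
have Dk1 s : is_derive (s : R) (1 : R) k1 (k2 s).
  pose G s := g1 s - d * g s.
  have DG : is_derive (s : R) (1 : R) G (g2 s - d * g1 s).
    exact: is_deriveB (Dg1 s) (is_deriveZ d (Dg s)).
  rewrite (_ : k1 = E \* G)//.
  by apply: is_derive_eq; rewrite /k2 /GRing.scale /= /G; ring.
have gE s : g s = s ^+ j * s ^+ 2 * (1 - eps * s ^+ j.+2).
  by rewrite /g !exprS exprD; ring.
have Egt s : 0 < E s by exact: expR_gt0.
have kb : k (2 * s0) <= 0.
  rewrite /k pmulr_rle0// gE pmulr_rle0; last by rewrite mulr_gt0 ?exprn_gt0// mulr_gt0.
  have -> : eps * (2 * s0) ^+ j.+2 = 2 ^+ j.+1.
    rewrite exprMn [2 ^+ j.+2]exprS /eps; field.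
    by rewrite expf_neq0// gt_eqF.
  by rewrite subr_le0 exprn_ege1//; lra.
have := radial_comparison Hu Dk Dk1 (m := K / c0) _ _ _ kb (x := x).
rewrite -/s0 => H.
have : k s0 <= K / c0 * u x.
  apply: H.
  - move=> s sa; have s_gt0 : 0 < s by exact: lt_trans sa.
    rewrite /k pmulr_rgt0// gE pmulr_rgt0 ?mulr_gt0 ?exprn_gt0// subr_gt0.
    move=> theta1; rewrite -/d.
    rewrite (_ : _ + _ = E s * (g2 s - d * g1 s + q s * g s)); last first.
      by rewrite gE /k1 /k2 gE; ring.
    rewrite pmulr_rgt0// gE.
    set th := eps * s ^+ j.+2 in theta1 *.
    have th0 : 0 < th by rewrite mulr_gt0 ?exprn_gt0.
    have := hq s (ltW sa); rewrite -/d -/n; set Q := q s * s => hQ.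
    rewrite (_ : _ + _ = s ^+ j * (n * (n - 1) - 2 * n * (2 * n - 1) * th
       - d * n * s * (1 - 2 * th) + Q * (s * (1 - th)))); last first.
      rewrite /g2 /g1 /Q /th !exprS exprD -!natr1 natrD jE; ring.
    rewrite pmulr_rgt0 ?exprn_gt0//.
    have ds : 4 * n <= d * s.
      by apply: le_trans ha _; rewrite ler_wpM2l ?ltW.
    have s1th : 0 <= s * (1 - th) by rewrite mulr_ge0 ?ltW// subr_gt0.
    have QM := ler_wpM2r s1th hQ.
    have nn : 0 < n * (n - 1) by rewrite mulr_gt0//; lra.
    have nth : 0 <= n * th * (d * s - 2 * (2 * n - 1)).
      have n0 : 0 <= n by lra.
      apply: mulr_ge0; first exact: mulr_ge0 n0 (ltW th0).
      have ds' : 0 <= d * s - 4 * n by rewrite subr_ge0.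
      by lra.
    lra.
  - by rewrite divr_ge0 ?ltW.
  - move=> y /uc cy; apply: (@le_trans _ _ K).
      by rewrite /k /K ler_pM2l// /g gerBl mulr_ge0 ?ltW// exprn_gt0.
    by rewrite -mulrA ler_peMr ?(ltW K0)// mulrC ler_pdivlMr// mul1r.
  - rewrite ax /=; apply: le_trans (_ : expR s0 <= _); first by rewrite lnK.
    by rewrite ler_expR; lra.
have -> : k s0 = expR ((2 - N%:R) * s0) * s0 ^+ j.+2 / 2.
  rewrite /k /g (_ : (j + j).+4 = (j.+2 + j.+2)%N); last by rewrite !addnS !addSn.
  rewrite /eps /E /d opprB exprD.
  by field; rewrite expf_neq0// gt_eqF.
move=> lower; have c0K : 0 <= c0 / K by rewrite divr_ge0 ?ltW.
have := ler_wpM2l c0K lower; rewrite [_ * (_ * u x)]mulrA.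
rewrite (_ : c0 / K * (K / c0) = 1) ?mul1r; last by field; rewrite !gt_eqF.
apply: le_trans; rewrite le_eqVlt; apply/orP; left; apply/eqP; field.
by rewrite gt_eqF.
Qed.

(** The barrier is [|x|^(- (N - 2) / 2) sin (ka (ln |x| - a))], which solves
[k'' + (N - 2) k' + ((N - 2)^2 / 4 + ka^2) k = 0] and vanishes on both boundary
spheres of the annulus [a <= ln |x| <= a + pi / ka].  When
[(N - 2)^2 / 4 + ka^2 < lam] it is a strict subsolution, so comparison with
[m = 0] forces it to be nonpositive, which fails halfway. *)
Lemma hardy_nonexistence U u (lam a : R) : (0 < N)%N ->
  (N%:R - 2) ^+ 2 / 4 < lam ->
  ~ log_potential_supersolution U (fun=> lam) a u.
Proof.
move=> N0 hlam Hu.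
pose be : R := (N%:R - 2) / 2.
have be2 : be ^+ 2 = (N%:R - 2) ^+ 2 / 4 by rewrite /be; field.
(* Half of the gap between [lam] and the Hardy constant keeps strictness. *)
pose ka := Num.sqrt ((lam - be ^+ 2) / 2).
have ka0 : 0 < ka by rewrite sqrtr_gt0 divr_gt0// be2 subr_gt0.
have ka2 : ka ^+ 2 = (lam - be ^+ 2) / 2.
  by rewrite sqr_sqrtr// divr_ge0// be2 subr_ge0 ltW.
pose E s := expR (- be * s); pose th s := ka * (s - a).
pose k s := E s * sin (th s).
pose k1 s := E s * (ka * cos (th s) - be * sin (th s)).
pose k2 s := E s * ((be ^+ 2 - ka ^+ 2) * sin (th s) - 2 * be * ka * cos (th s)).
have DE s : is_derive (s : R) (1 : R) E (- be * E s) by exact: is_derive_expZ.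
have Dth s : is_derive (s : R) (1 : R) th ka.
  by apply: is_derive_eq; rewrite /GRing.scale /=; ring.
have Dsin s : is_derive (s : R) (1 : R) (sin \o th) (cos (th s) * ka).
  exact: is_derive1_comp.
have Dcos s : is_derive (s : R) (1 : R) (cos \o th) (- sin (th s) * ka).
  exact: is_derive1_comp.
have Dk s : is_derive (s : R) (1 : R) k (k1 s).
  rewrite (_ : k = E \* (sin \o th))//.
  by apply: is_derive_eq; rewrite /k1 /GRing.scale /=; ring.
have Dk1 s : is_derive (s : R) (1 : R) k1 (k2 s).
  pose C s := ka * cos (th s) - be * sin (th s).
  have DC : is_derive (s : R) (1 : R) C
      (ka * (- sin (th s) * ka) - be * (cos (th s) * ka)).
    exact: is_deriveB (is_deriveZ ka (Dcos s)) (is_deriveZ be (Dsin s)).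
  rewrite (_ : k1 = E \* C)//.
  by apply: is_derive_eq; rewrite /k2 /GRing.scale /= /C; ring.
pose b := a + pi / ka.
have kb : k b <= 0.
  rewrite /k (_ : th b = pi) ?sinpi ?mulr0//.
  by rewrite /th /b; field; rewrite gt_eqF.
pose s0 := a + pi / 2 / ka.
pose x : 'rV[R]_N := expR s0 *: delta_mx ord0 (Ordinal N0).
have xE : enorm x = expR s0 by rewrite enorm_scale_delta ?expR_ge0.
have pik : 0 < pi / 2 / ka by rewrite !divr_gt0 ?pi_gt0.
have s0b : s0 <= b.
  by rewrite /s0 /b lerD2l ler_pM2r ?invr_gt0// ler_pdivrMr//; have := pi_gt0 R; lra.
have := radial_comparison Hu Dk Dk1 (m := 0) _ _ _ kb (x := x).
rewrite mul0r xE expRK !ler_expR s0b andbT => H.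
have : k s0 <= 0.
  apply: H => //.
  - move=> s _ ks; rewrite (_ : _ + _ = ka ^+ 2 * k s).
      by rewrite mulr_gt0// exprn_gt0.
    rewrite /k /k1 /k2 (_ : lam = be ^+ 2 + 2 * ka ^+ 2); last by rewrite ka2; field.
    rewrite (_ : N%:R = 2 * be + 2); last by rewrite /be; field.
    by ring.
  - by move=> y _; rewrite mul0r /k /th subrr mulr0 sin0 mulr0.
  - by rewrite /s0 lerDl ltW.
rewrite /k (_ : th s0 = pi / 2); last by rewrite /th /s0; field; rewrite gt_eqF.
by rewrite sin_pihalf mulr1 leNgt expR_gt0.
Qed.

End Barriers.

(** * Growth conditions at infinity *)

Section Growth.
Context {R : realType} {N : nat}.
Implicit Types (x : 'rV[R]_N) (f : 'rV[R]_N -> R).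

(** The parameter [a0] allows the threshold to be taken beyond earlier ones. *)
Lemma limf_einf_at_infty_gt f (c a0 : R) :
  (c%:E < limf_einf (fun x => (f x)%:E) at_infty)%E ->
  exists l a, [/\ c < l, a0 <= a & forall x, expR a <= enorm x -> l <= f x].
Proof.
rewrite limf_einfE => /ereal_sup_gt[_ [A [M MA] <-]] cA.
have [l cl lA] : exists2 l : R, c < l & (l%:E <= ereal_inf [set (f x)%:E | x in A])%E.
  case: (ereal_inf _) cA => [r| |]; rewrite ?lte_fin.
  - by exists r.
  - by exists (c + 1); rewrite ?leey// ltrDl.
  - by rewrite ltNge leNye.
exists l, (Num.max a0 (M + 1)); split=> //; first by rewrite le_max lexx.
move=> x ax; rewrite -lee_fin (le_trans lA)//; apply: ereal_inf_lbound.
exists x => //; apply: MA; apply: lt_le_trans ax.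
have := expR_ge1Dx (Num.max a0 (M + 1)).
have : M + 1 <= Num.max a0 (M + 1) by rewrite le_max lexx orbT.
by lra.
Qed.

Lemma powR_exprn_enorm (r : R) (n : nat) : 0 < r ->
  r `^ (2 - n%:R) * r ^+ n = r ^+ 2.
Proof.
move=> r0; rewrite -powR_mulrn ?ltW// -powRD ?subrK; last by rewrite gt_eqF ?implybT.
by rewrite powR_mulrn ?ltW.
Qed.

Lemma powR_beyond_ge (p C a0 : R) : 0 < p -> 0 < C ->
  exists2 a, a0 <= a & forall s, a <= s -> C <= s `^ p.
Proof.
move=> p0 C0; exists (Num.max a0 (C `^ p^-1)); first by rewrite le_max lexx.
move=> s; rewrite ge_max => /andP[_ Cs].
have -> : C = (C `^ p^-1) `^ p by rewrite -powRrM mulVf ?gt_eqF// powRr1// ltW.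
have s0 : 0 <= s by exact: le_trans (powR_ge0 _ _) Cs.
by apply: ge0_ler_powR => //; rewrite ?nnegrE ?powR_ge0// ltW.
Qed.

End Growth.

(** * Nonexistence *)

Theorem theorem1p1 (R : realType) (N : nat) (Omega : set 'rV[R]_N)
    (h ht : 'rV[R]_N -> R -> R)
  (hN : (3 <= N)%N)
  (hOmega : punctured_or_exterior Omega)
  (hball : ~` eball (expR 1) `<=` Omega)
  (hmeas : lebesgue_measurable_fun
             (Omega `*` [set s : R | 0 <= s]) (fun p => h p.1 p.2))
  (ht_ge0 : forall x s, Omega x -> 0 <= s -> 0 <= ht x s)
  (h_ge_ht : forall x s, (~` eball (expR 1)) x -> 0 <= s -> ht x s <= h x s)
  (cond_a : forall x, (~` eball (expR 1)) x ->
     forall s1 s2 : R, 0 < s2 -> s2 <= s1 -> ht x s2 / s2 <= ht x s1 / s1)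
  (cond_b :
     (forall t : R, 0 < t ->
        (((N%:R - 2) ^+ 2 / 4)%:E <
         limf_einf (fun x : 'rV[R]_N =>
           (ht x (t * enorm x `^ (2 - N%:R)) * enorm x ^+ N)%:E)
           at_infty)%E)
     \/
     ((exists sigma1 : R, 0 < sigma1 < 1 /\
        forall t : R, 0 < t ->
        (0 <
         limf_einf (fun x : 'rV[R]_N =>
           (ht x (t * enorm x `^ (2 - N%:R)) * enorm x ^+ N
            * ln (enorm x) `^ sigma1)%:E)
           at_infty)%E)
      /\
      (exists sigma2 : R, 0 < sigma2 /\
        forall t : R, 0 < t ->
        (((N%:R - 2) ^+ 2 / 4)%:E <
         limf_einf (fun x : 'rV[R]_N =>
           (ht x (t * enorm x `^ (2 - N%:R) * ln (enorm x) `^ sigma2)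
            / (t * enorm x ^- N * ln (enorm x) `^ sigma2))%:E)
           at_infty)%E))) :
  ~ exists u : 'rV[R]_N -> R, positive_supersolution Omega h u.
Proof.
move=> [u [Cu Hu]].
have oOmega : open Omega by case: hOmega => O [_ cO _ ->]; exact: closed_openC.
have N2r : 2 < N%:R :> R by rewrite ltr_nat.
have outside (a : R) (x : 'rV[R]_N) :
    1 <= a -> expR a <= enorm x -> (~` eball (expR 1)) x.
  by move=> a1 ax; apply/negP; rewrite -leNgt (le_trans _ ax)// ler_expR.
(* A lower bound [w] of [u] linearizes the equation: [ht x (u x) / u x] is at least
   [ht x (w x) / w x]. *)
have potential (q : R -> R) (w : 'rV[R]_N -> R) (a : R) : 1 <= a ->
    (forall x, expR a <= enorm x ->
      [/\ 0 < w x, w x <= u x & q (ln (enorm x)) * w x <= enorm x ^+ 2 * ht x (w x)]) ->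
    log_potential_supersolution Omega q a u.
  move=> a1 Hw; split=> // x ax; have ex := outside a x a1 ax.
  have Ox := hball x ex; have [ux0 sx] := Hu x Ox; have [w0 wu qw] := Hw x ax.
  split=> //; rewrite -mulrN.
  apply: (@le_trans _ _ (enorm x ^+ 2 * ht x (u x))); last first.
    by rewrite ler_wpM2l ?sqr_ge0// (le_trans _ sx)// h_ge_ht// ltW.
  rewrite -ler_pdivlMr// -mulrA.
  apply: le_trans (_ : enorm x ^+ 2 * (ht x (w x) / w x) <= _).
    by rewrite mulrA ler_pdivlMr.
  by rewrite ler_wpM2l ?sqr_ge0// cond_a.
have superharmonic : log_potential_supersolution Omega (fun=> 0) 1 u.
  apply: (potential _ u) => // x ax; have Ox := hball x (outside 1 x (lexx 1) ax).
  have [ux0 _] := Hu x Ox; split=> //.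
  by rewrite mul0r mulr_ge0 ?sqr_ge0// ht_ge0// ltW.
have [c c0 uc] := fundamental_lower_bound hN ler01 superharmonic.
have {}uc x : expR 1 <= enorm x -> c * enorm x `^ (2 - N%:R) <= u x.
  move=> ax; have [x0 _] := expR_le_ln ax.
  by have := uc x ax; rewrite /powR gt_eqF.
have N0 : (0 < N)%N by exact: leq_trans hN.
have H1 (a : R) (x : 'rV[R]_N) : 1 <= a -> expR a <= enorm x ->
    [/\ 0 < enorm x, a <= ln (enorm x), expR 1 <= enorm x & 0 < enorm x `^ (2 - N%:R)].
  move=> a1 ax; have [x0 aln] := expR_le_ln ax; split=> //; last exact: powR_gt0.
  by rewrite (le_trans _ ax)// ler_expR.
case: cond_b => [cond_b|[[sig [/andP[sig0 sig1] cond_b1]] [sig2 [sig20 cond_b2]]]].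
  (* The limit inferior is not divided by [t], so the potential is bounded below by
     [lam / t] times [|x|^-2]; taking [t <= 1] keeps the constant above [lam]. *)
  pose t := Num.min c 1.
  have t0 : 0 < t by rewrite lt_min c0 ltr01.
  have [lam [a [hlam a1 Hlam]]] := limf_einf_at_infty_gt 1 (cond_b t t0).
  have lam0 : 0 < lam by apply: le_lt_trans hlam; rewrite divr_ge0 ?sqr_ge0.
  apply: (hardy_nonexistence N0 hlam (a := a) (U := Omega) (u := u)).
  apply: (potential _ (fun x => t * enorm x `^ (2 - N%:R))) => // x ax.
  have [x0 aln x1 E0] := H1 a x a1 ax; split; first exact: mulr_gt0.
    apply: le_trans (uc x x1); by rewrite ler_wpM2r ?(ltW E0)// ge_min lexx.
  rewrite -(powR_exprn_enorm N x0) -[leRHS]mulrA mulrCA ![lam * _]mulrC.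
  rewrite [leLHS]mulrCA ler_wpM2l ?(ltW E0)//.
  rewrite [_ ^+ N * _]mulrC; apply: le_trans (Hlam x ax).
  by rewrite ler_piMl ?(ltW lam0)// ge_min lexx orbT.
(* [q s * s] is a multiple of [s ^ (1 - sig)], which is unbounded: every power of
   the logarithm can be gained, in particular an integer one above [sig2]. *)
have [del [a1 [del0 a11 Hdel]]] := limf_einf_at_infty_gt 1 (cond_b1 c c0).
pose q s := del / c / s `^ sig.
have Hq : log_potential_supersolution Omega q a1 u.
  apply: (potential _ (fun x => c * enorm x `^ (2 - N%:R))) => // x ax.
  have [x0 aln x1 E0] := H1 a1 x a11 ax; split; [exact: mulr_gt0|exact: uc|].
  have s0 : 0 < ln (enorm x) by rewrite (lt_le_trans _ aln)// (lt_le_trans _ a11).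
  have S0 : 0 < ln (enorm x) `^ sig by rewrite powR_gt0.
  rewrite /q (_ : _ * _ = enorm x `^ (2 - N%:R) * (del / ln (enorm x) `^ sig)).
    rewrite -(powR_exprn_enorm N x0) -[leRHS]mulrA ler_wpM2l ?(ltW E0)//.
    by rewrite ler_pdivrMr// [_ ^+ N * _]mulrC; exact: Hdel.
  by field; rewrite !gt_eqF.
pose j := Num.truncn sig2; pose d : R := N%:R - 2.
have d0 : 0 < d by rewrite subr_gt0.
have sig1' : 0 < 1 - sig by rewrite subr_gt0.
have C0 : 0 < d * j.+2%:R / (del / c) by rewrite !divr_gt0// mulr_gt0.
have [a2 a12 Ha2] := powR_beyond_ge (Num.max a1 (4 * j.+2%:R / d)) sig1' C0.
move: a12; rewrite ge_max => /andP[a12 da2].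
have a21 : 1 <= a2 by exact: le_trans a12.
have a20 : 0 < a2 by exact: lt_le_trans a21.
have [||c' c'0 uc'] := log_power_lower_bound (j := j) hN a20 _ _
    (log_potential_supersolution_le a12 Hq).
- move=> s sa; have s0 : 0 < s by exact: lt_le_trans sa.
  have := Ha2 s sa; rewrite ler_pdivrMr ?divr_gt0// -/d => /le_trans; apply.
  rewrite /q powRD ?powRr1 ?(ltW s0)//; last by rewrite gt_eqF ?implybT.
  rewrite powRN le_eqVlt; apply/orP; left; apply/eqP; ring.
- by rewrite -/d mulrC [d * _]mulrC -ler_pdivrMr// mulrC.
have [lam [a3 [hlam a32 Hlam]]] := limf_einf_at_infty_gt a2 (cond_b2 c' c'0).
have a31 : 1 <= a3 by exact: le_trans a32.
apply: (hardy_nonexistence N0 hlam (a := a3) (U := Omega) (u := u)).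
apply: (potential _ (fun x =>
  c' * enorm x `^ (2 - N%:R) * ln (enorm x) `^ sig2)) => // x ax.
have [x0 aln x1 E0] := H1 a3 x a31 ax.
have s0 : 0 < ln (enorm x) by rewrite (lt_le_trans _ aln)// (lt_le_trans _ a31).
have S0 : 0 < ln (enorm x) `^ sig2 by rewrite powR_gt0.
split; first by rewrite !mulr_gt0.
  have x2 : expR a2 <= enorm x by rewrite (le_trans _ ax)// ler_expR.
  apply: le_trans (uc' x x2); rewrite -mulrA ler_wpM2l ?(ltW c'0)//.
  rewrite /powR (gt_eqF x0) -/(powR _ _) ler_wpM2l ?expR_ge0//.
  rewrite -powR_mulrn ?(ltW s0)// ler_powR//; first exact: le_trans a31 aln.
  have := Num.Theory.truncnS_gt sig2; rewrite -/j => /ltW /le_trans; apply.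
  by rewrite ler_nat.
have := Hlam x ax; rewrite ler_pdivlMr; last by rewrite !mulr_gt0// invr_gt0 exprn_gt0.
move=> /(ler_wpM2l (sqr_ge0 (enorm x))); apply: le_trans.
rewrite -(powR_exprn_enorm N x0) le_eqVlt; apply/orP; left; apply/eqP; field.
by rewrite expf_neq0// gt_eqF.
Qed.
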